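(* Let $G$ be a connected non-complete graph with $n$ vertices and $m$ edges, where $m\le\frac14\bigl(n^{4/3}-n^{1/3}\bigr)$. Then there exists $\alpha_G\in(0,1]$ such that for all real $\alpha$: $\mathrm{Sz}^{\alpha}(G)>W^{\alpha}(G)$ if $\alpha>\alpha_G$, $\mathrm{Sz}^{\alpha}(G)=W^{\alpha}(G)$ if $\alpha=\alpha_G$, and $\mathrm{Sz}^{\alpha}(G)<W^{\alpha}(G)$ if $\alpha<\alpha_G$.
   Context: For an edge $uv$ of $G$, $n_u(v)$ is the number of vertices strictly closer to $u$ than to $v$ (including $u$), and $n_v(u)$ symmetrically. $W^{\alpha}(G)=\sum_{\{u,v\}}d(u,v)^{\alpha}$ over unordered pairs of distinct vertices, and $\mathrm{Sz}^{\alpha}(G)=\sum_{uv\in E(G)}(n_u(v)n_v(u))^{\alpha}$. *)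

(* Defs.v *)
From HB Require Import structures.
From mathcomp Require Import all_boot all_order all_algebra.
From mathcomp Require Import all_classical all_reals exp.

Set Implicit Arguments.
Unset Strict Implicit.
Unset Printing Implicit Defensive.

Import Order.TTheory GRing.Theory Num.Theory.
Local Open Scope ring_scope.

Definition simple_graph (T : finType) (e : rel T) : Prop :=
  symmetric e /\ irreflexive e.

Definition connected_graph (T : finType) (e : rel T) : Prop :=
  (0 < #|T|)%N /\ forall x y : T, connect e x y.

Definition complete_graph (T : finType) (e : rel T) : Prop :=
  forall x y : T, x != y -> e x y.

Definition walk_of_length (T : finType) (e : rel T) (x y : T) (k : nat) : bool :=
  [exists p : k.-tuple T, path e x p && (last x p == y)].

(* Least length of a walk from x to y; junk value #|T| if y is not reachable
   from x. A shortest walk has length at most #|T| - 1. *)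
Definition dist (T : finType) (e : rel T) (x y : T) : nat :=
  find (walk_of_length e x y) (iota 0 #|T|).

(* Unordered pairs of distinct vertices, each represented once, by listing
   first the endpoint that comes first in the enumeration of T. *)
Definition vpairs (T : finType) : {set T * T} :=
  [set p : T * T | (enum_rank p.1 < enum_rank p.2)%N].

Definition edges (T : finType) (e : rel T) : {set T * T} :=
  [set p in vpairs T | e p.1 p.2].

Definition nb_closer (T : finType) (e : rel T) (u v : T) : nat :=
  #|[set w : T | (dist e w u < dist e w v)%N]|.

Definition wiener (R : realType) (T : finType) (e : rel T) (alpha : R) : R :=
  \sum_(p in vpairs T) (dist e p.1 p.2)%:R `^ alpha.

Definition szeged (R : realType) (T : finType) (e : rel T) (alpha : R) : R :=
  \sum_(p in edges e)
    (nb_closer e p.1 p.2 * nb_closer e p.2 p.1)%:R `^ alpha.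

Lemma dist_le (T : finType) (e : rel T) (x : T) (p : seq T) :
  path e x p -> (dist e x (last x p) <= size p)%N.
Proof.
move=> xp; rewrite leqNgt; apply/negP => lt_p.
have ltT : (size p < #|T|)%N.
  by apply: leq_trans lt_p _; rewrite -[X in (_ <= X)%N](size_iota 0) find_size.
have := before_find 0%N lt_p; rewrite nth_iota // add0n => /negbT/fintype.existsP; apply.
by exists (in_tuple p); rewrite xp eqxx.
Qed.

Lemma dist_path (T : finType) (e : rel T) (x y : T) : connect e x y ->
  exists p, [/\ path e x p, last x p = y & size p = dist e x y].
Proof.
case/connectP => q0 /shortenP[q xq uq _] ->.
have ltq : (size q < #|T|)%N by have := card_uniqP uq => /= <-; exact: max_card.
have hasq : has (walk_of_length e x (last x q)) (iota 0 #|T|).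
  apply/hasP; exists (size q); first by rewrite mem_iota.
  by apply/fintype.existsP; exists (in_tuple q); rewrite xq eqxx.
have ltd : (dist e x (last x q) < #|T|)%N.
  by rewrite /dist -[X in (_ < X)%N](size_iota 0) -has_find.
have := nth_find 0%N hasq; rewrite nth_iota // add0n.
case/fintype.existsP => p /andP[xp /eqP lp].
by exists p; split; rewrite ?size_tuple.
Qed.

Lemma mem_vpairs (T : finType) (u v : T) : u != v ->
  ((u, v) \in vpairs T) = ((v, u) \notin vpairs T).
Proof.
move=> uv; rewrite !inE /= -leqNgt ltn_neqAle.
by rewrite (inj_eq val_inj) (inj_eq enum_rank_inj) uv.
Qed.

(* Main.v *)
Require Import Defs.
From HB Require Import structures.
From mathcomp Require Import all_boot all_order all_algebra.
From mathcomp Require Import all_classical all_reals exp.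
From mathcomp Require Import topology normedtype sequences zify ring lra.

Import Order.TTheory GRing.Theory Num.Theory.
Import numFieldNormedType.Exports.
Local Open Scope ring_scope.

(** Write D for the diameter, and x(uv) = n_u(v) n_v(u) for an edge uv.

    The inequality W <= Sz at exponent 1 holds because each of the d(x, y)
    edges of a geodesic from x to y separates x from y.

    Suppose 0 < a <= 1, a < b and W^a <= Sz^a. Bernoulli's inequality
    (x/D)^b >= 1 + (b/a) ((x/D)^a - 1), summed over the edges, bounds Sz^b / D^b
    from below by Sz^a / D^a + (b/a - 1) (Sz^a / D^a - m), whereas
    W^b / D^b <= W^a / D^a since every distance is at most D. So W^b < Sz^b as
    soon as m D^a < W^a, and because (d/D)^a >= d/D it is enough that m D < W.

    With c = n^(1/3), the hypothesis reads m <= c (n - 1) / 4. If D <= 2 c then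
    m D <= c^2 (n - 1) / 2 < n (n - 1) / 2 <= W. If D > 2 c, summing the distances
    from every vertex to a diametral geodesic gives 8 W >= n D (D + 2) > 8 m D.

    For a <= 0 one has Sz^a <= m < W^a, so the sign of Sz^a - W^a changes exactly
    once, at a point of ]0, 1] provided by the intermediate value theorem. *)

Set Implicit Arguments.
Unset Strict Implicit.
Unset Printing Implicit Defensive.

(** * Real powers and power sums as functions of the exponent *)

Section PowerSums.
Variable R : realType.

(** With u = ln y, use 1 + t <= exp t at t = (b - a) u and t = - a u. Under the weights a and b - a
    the terms in u cancel; multiplying by y^a concludes. *)
Lemma powR_bernoulli (y a b : R) : 0 < y -> 0 < a -> a < b ->
  a + b * (y `^ a - 1) <= a * y `^ b.
Proof.
move=> y0 a0 ab; rewrite /powR gt_eqF //; set u := ln y.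
have -> : expR (b * u) = expR (a * u) * expR ((b - a) * u).
  by rewrite -expRD; congr expR; ring.
have : expR (a * u) * expR (- (a * u)) = 1 by rewrite -expRD subrr expR0.
have := expR_ge1Dx ((b - a) * u); have := expR_ge1Dx (- (a * u)).
have := expR_gt0 (a * u).
set E := expR (a * u); set F := expR ((b - a) * u); set G := expR (- (a * u)).
move=> E0 leG leF EG.
have : b * E <= E * (a * F + (b - a) * G).
  rewrite mulrC ler_pM2l //.
  have := ler_wpM2l (ltW a0) leF; have := ler_wpM2l (_ : 0 <= b - a) leG; lra.
by rewrite mulrDr (mulrCA E (b - a)) EG; lra.
Qed.

Lemma power_sum_lt (I J : finType) (A : {set I}) (B : {set J})
    (x : I -> R) (d : J -> R) (D a b : R) :
  {in A, forall i, 0 < x i} -> {in B, forall j, 0 < d j <= D} -> 0 < D ->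
  #|A|%:R * D < \sum_(j in B) d j -> 0 < a <= 1 -> a < b ->
  \sum_(j in B) d j `^ a <= \sum_(i in A) x i `^ a ->
  \sum_(j in B) d j `^ b < \sum_(i in A) x i `^ b.
Proof.
move=> x0 dD D0 lt_mD /andP[a0 a1] ab le_a.
have scale (K : finType) (C : {set K}) (f : K -> R) r : {in C, forall k, 0 < f k} ->
    \sum_(k in C) f k `^ r = D `^ r * \sum_(k in C) (f k / D) `^ r.
  move=> f0; rewrite mulr_sumr; apply: eq_bigr => k /f0 fk.
  by rewrite -powRM ?divr_ge0 ?(ltW D0) ?(ltW fk) // mulrC divfK // gt_eqF.
have d0 : {in B, forall j, 0 < d j} by move=> j /dD/andP[].
move: le_a; rewrite !(scale _ A x) // !(scale _ B d) // ler_pM2l ?powR_gt0 // ltr_pM2l ?powR_gt0 //.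
set Wa := \sum_(j in B) _; set Sa := \sum_(i in A) _ => le_a.
have dj j : j \in B -> 0 < d j / D <= 1.
  by move=> /dD /andP[dj0 djD]; rewrite divr_gt0 // ler_pdivrMr // mul1r.
(* As a <= 1, a ratio d/D in ]0, 1] is at most its a-th power. *)
have lt_mW : #|A|%:R < Wa.
  have : #|A|%:R < \sum_(j in B) d j / D by rewrite -mulr_suml ltr_pdivlMr.
  move/lt_le_trans; apply; apply: ler_sum => j /dj jB.
  exact: ger1_powR.
have le_b : \sum_(j in B) (d j / D) `^ b <= Wa.
  by apply: ler_sum => j /dj jB; apply: ger_powR => //; exact: ltW.
apply: (le_lt_trans le_b).
have : \sum_(i in A) (a + b * ((x i / D) `^ a - 1)) <= a * \sum_(i in A) (x i / D) `^ b.
  rewrite mulr_sumr; apply: ler_sum => i /x0 xi.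
  by apply: powR_bernoulli; rewrite ?divr_gt0.
rewrite big_split /= -mulr_sumr big_split /= !sumr_const mulNrn -/Sa.
rewrite -[a *+ _]mulr_natr.
move=> leB; rewrite -(ltr_pM2l a0).
(* Strictness comes from [Sa] >= [Wa] > #|A|. *)
have : 0 < (b - a) * (Sa - #|A|%:R) by rewrite mulr_gt0 ?subr_gt0 // (lt_le_trans lt_mW).
have := ler_wpM2l (ltW a0) le_a; lra.
Qed.

(** [powR] is defined by cases at base 0; for positive bases each term is exp (r ln x). *)
Lemma continuous_power_sum (I : finType) (A : {set I}) (x : I -> R) :
  {in A, forall i, 0 < x i} -> continuous (fun r : R => \sum_(i in A) x i `^ r).
Proof.
move=> x0 r; apply: cvg_big => [|i Ai]; first exact: add_continuous.
rewrite /powR gt_eqF ?x0 //.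
apply: continuous_comp; last exact: continuous_expR.
by apply: cvgM; [exact: cvg_id|exact: cvg_cst].
Qed.
End PowerSums.

(** * Graph distance, geodesics and bounds on the Wiener index *)

Section Graph.
Local Open Scope nat_scope.
Variables (T : finType) (e : rel T).
Hypotheses (e_simple : simple_graph e) (e_conn : connected_graph e).

Lemma distxx (x : T) : dist e x x = 0.
Proof. by have := @dist_le T e x [::] isT; rewrite leqn0 => /eqP. Qed.

Lemma dist_eq0 (x y : T) : (dist e x y == 0) = (x == y).
Proof.
apply/eqP/eqP=> [d0|->]; last exact: distxx.
have [p [_ lp sp]] := dist_path (e_conn.2 x y).
by move: sp lp; rewrite d0; case: p.
Qed.

Lemma dist_triangle (x y z : T) : dist e x z <= dist e x y + dist e y z.
Proof.
have [p [xp lp <-]] := dist_path (e_conn.2 x y).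
have [q [yq lq <-]] := dist_path (e_conn.2 y z).
have -> : z = last x (p ++ q) by rewrite last_cat lp lq.
by rewrite -size_cat; apply: dist_le; rewrite cat_path xp lp.
Qed.

Lemma dist_sym (x y : T) : dist e x y = dist e y x.
Proof.
suff le a b : dist e a b <= dist e b a by apply/eqP; rewrite eqn_leq !le.
have [p [bp <- <-]] := dist_path (e_conn.2 b a).
have /dist_le : path e (last b p) (rev (belast b p)).
  by rewrite rev_path; under eq_path do rewrite /= e_simple.1.
by rewrite size_rev size_belast; case: p {bp} => //= c p; rewrite rev_cons last_rcons.
Qed.

Lemma dist_edge (x y : T) : e x y -> dist e x y = 1.
Proof.
move=> exy; apply/eqP; rewrite eqn_leq lt0n dist_eq0.
rewrite (@dist_le _ e x [:: y]) ?andTb /= ?exy //.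
by apply/eqP=> xy; move: exy; rewrite xy e_simple.2.
Qed.

(** A shortest path bounds the distances from its i-th vertex to x and y by i and d(x, y) - i; the
    triangle inequality forces equality in both. *)
Lemma geodesicP (x y : T) :
  exists p : nat -> T,
    [/\ forall i, i < dist e x y -> e (p i) (p i.+1),
        forall i, i <= dist e x y -> dist e x (p i) = i &
        forall i, i <= dist e x y -> dist e (p i) y = dist e x y - i].
Proof.
have [s [xs ls ss]] := dist_path (e_conn.2 x y).
exists (nth x (x :: s)).
have last_take i : i <= size s -> last x (take i s) = nth x (x :: s) i.
  by move=> le_is; rewrite (last_nth x) size_takel //; case: i le_is => //= i ?; rewrite nth_take.
have Hx i : i <= size s -> dist e x (nth x (x :: s) i) <= i.
  move=> le_is; rewrite -last_take // -[leqRHS](size_takel le_is).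
  by apply: dist_le; exact: take_path.
have Hy i : i <= size s -> dist e (nth x (x :: s) i) y <= size s - i.
  move=> le_is; have := xs; rewrite -{1}(cat_take_drop i s) cat_path last_take // => /andP[_].
  by move/dist_le; rewrite size_drop -last_take // -last_cat cat_take_drop ls.
rewrite -ss; split=> i lis.
- by move/(pathP x): xs => /(_ i lis).
- have := dist_triangle x (nth x (x :: s) i) y; have := Hx i lis; have := Hy i lis; lia.
- have := dist_triangle x (nth x (x :: s) i) y; have := Hx i lis; have := Hy i lis; lia.
Qed.

(** Swapping coordinates maps [vpairs T] onto the other off-diagonal pairs; irreflexivity of [P]
    excludes the diagonal. *)
Lemma big_vpairs (g : T -> T -> nat) (P : rel T) :
  (forall x y, g x y = g y x) -> symmetric P -> irreflexive P ->
  2 * (\sum_(p in vpairs T | P p.1 p.2) g p.1 p.2) = \sum_(p | P p.1 p.2) g p.1 p.2.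
Proof.
move=> gC PC PI; rewrite mul2n -addnn [RHS](bigID (mem (vpairs T))) /=.
congr (_ + _); first by apply: eq_bigl => p; rewrite andbC.
rewrite (reindex_inj (h := fun p : T * T => (p.2, p.1))) /=; last by move=> [a b] [c d] [-> ->].
under eq_bigr do rewrite gC.
apply: eq_bigl => -[x y] /=; rewrite PC andbC.
have [->|xy] := eqVneq x y; first by rewrite PI.
by rewrite [in RHS]mem_vpairs // negbK.
Qed.

Lemma big_vpairs_neq (g : T -> T -> nat) : (forall x y, g x y = g y x) ->
  2 * (\sum_(p in vpairs T) g p.1 p.2) = \sum_x \sum_(y | y != x) g x y.
Proof.
move=> gC; rewrite pair_big_dep /=.
rewrite -(big_vpairs gC (P := fun x y => y != x));
  [|by move=> x y; rewrite eq_sym|by move=> x; rewrite eqxx].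
congr (2 * _); apply: eq_bigl => -[x y] /=.
by have [->|_] := eqVneq y x; rewrite ?andbT // inE ltnn.
Qed.

(** Double counting of oriented edges [q] separating ordered pairs [p]: both sides are doubled, then
    the order of summation is exchanged. *)
Lemma wiener_le_szeged :
  \sum_(p in vpairs T) dist e p.1 p.2 <=
  \sum_(p in edges e) nb_closer e p.1 p.2 * nb_closer e p.2 p.1.
Proof.
rewrite -(leq_pmul2l (isT : 0 < 2)) big_vpairs_neq; last exact: dist_sym.
have -> : \sum_(p in edges e) nb_closer e p.1 p.2 * nb_closer e p.2 p.1 =
   \sum_(p in vpairs T | e p.1 p.2) nb_closer e p.1 p.2 * nb_closer e p.2 p.1.
  by apply: eq_bigl => p; rewrite [in LHS]inE.
rewrite (@big_vpairs (fun x y => nb_closer e x y * nb_closer e y x) e);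
  [|by move=> x y; rewrite mulnC|exact: e_simple.1|exact: e_simple.2].
rewrite pair_big_dep /=.
pose sep (q p : T * T) := (dist e p.1 q.1 < dist e p.1 q.2) &&
   (dist e p.2 q.2 < dist e p.2 q.1).
have -> : \sum_(q | e q.1 q.2) nb_closer e q.1 q.2 * nb_closer e q.2 q.1 =
     \sum_(q | e q.1 q.2) \sum_(p | sep q p) 1.
  apply: eq_bigr => q _; rewrite sum1_card -cardsX; apply: eq_card => p.
  by rewrite !inE.
rewrite (exchange_big_dep predT) //= big_mkcond; apply: leq_sum => -[x y] _ /=.
case: ifP => // _; rewrite sum1_card.
have [p [pe px py]] := geodesicP x y.
(* The i-th geodesic edge; its first endpoint is at distance i from x, whence injectivity. *)
pose h (i : 'I_(dist e x y)) := (p i, p i.+1).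
rewrite -[leqLHS]card_ord -(fintype.card_image (f := h)); last first.
  move=> i j [/(congr1 (dist e x))]; rewrite !px ?(ltnW (ltn_ord _)) // => ij _.
  exact: val_inj.
apply: fintype.subset_leq_card; apply/fintype.subsetP => q /fintype.imageP[i _ ->].
have lti := ltn_ord i.
rewrite unfold_in /= pe // /sep /= !px ?(ltnW lti) // !(dist_sym y) !py ?(ltnW lti) //.
by apply/andP; split; lia.
Qed.

Lemma card_vpairs : 2 * #|vpairs T| = #|T| * #|T|.-1.
Proof.
rewrite -sum1_card (big_vpairs_neq (g := fun _ _ => 1)) //.
rewrite -sum_nat_const; apply: eq_bigr => x _.
by rewrite sum1_card cardC1.
Qed.

(** With truncated subtraction the summand is |k - i|, so the sum splits at k into two triangular
    numbers. *)
Lemma sum_dist_nat (k j : nat) :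
  2 * \sum_(i < k + j.+1) ((k - i) + (i - k)) = k * k.+1 + j * j.+1.
Proof.
elim: j => [|j IHj].
  rewrite addn1 big_ord_recr /= subnn !addn0.
  under eq_bigr => i _ do have -> : k - i + (i - k) = k - i by have := ltn_ord i; lia.
  elim: k => [|k IHk]; first by rewrite big_ord0.
  rewrite big_ord_recl subn0; under eq_bigr do rewrite /= /bump /= add1n subSS.
  by rewrite mulnDr IHk; lia.
by rewrite addnS big_ord_recr /= mulnDr IHj; nia.
Qed.

(** A vertex at distance k from a is at distance at least |k - i| from the i-th vertex of a geodesic
    from a to b; these bounds are summed over i, then over all vertices. *)
Lemma wiener_lower_bound (a b : T) :
  (forall x, dist e a x <= dist e a b) ->
  #|T| * (dist e a b * (dist e a b).+2) <= 8 * \sum_(p in vpairs T) dist e p.1 p.2.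
Proof.
set D := dist e a b => maxD.
have -> : 8 * \sum_(p in vpairs T) dist e p.1 p.2 = 4 * \sum_v \sum_w dist e v w.
  rewrite -[8]/(4 * 2) -mulnA (big_vpairs_neq dist_sym); congr (4 * _).
  apply: eq_bigr => v _; rewrite [RHS](bigID (fun w => w != v)) /= [X in _ + X]big1 ?addn0 //.
  by move=> w /negPn/eqP->; rewrite distxx.
rewrite -sum_nat_const big_distrr /=; apply: leq_sum => v _.
have [p [_ pa _]] := geodesicP a b.
have inj : injective (fun i : 'I_D.+1 => p i).
  move=> i j /(congr1 (dist e a)); rewrite !pa -1?ltnS // => ij; exact: val_inj.
have le1 : \sum_(i < D.+1) dist e v (p i) <= \sum_w dist e v w.
  have := big_imset (idx := 0) (aop := addn) (A := 'I_D.+1) (dist e v) (in2W inj) => /= <-.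
  by rewrite [leqRHS](bigID (mem [set p i | i : 'I_D.+1])) leq_addr.
apply: leq_trans (leq_mul (leqnn 4) le1).
have le_vD := maxD v; set k := dist e a v in le_vD.
have le2 : \sum_(i < k + (D - k).+1) ((k - i) + (i - k)) <= \sum_(i < D.+1) dist e v (p i).
  rewrite addnS subnKC //; apply: leq_sum => i _.
  have := dist_triangle a v (p i); have := dist_triangle a (p i) v.
  by rewrite pa -1?ltnS // (dist_sym (p i) v) -/k; lia.
apply: leq_trans (leq_mul (leqnn 4) le2).
rewrite -[4]/(2 * 2) -mulnA sum_dist_nat.
(* This is (k + j)^2 <= 2 (k^2 + j^2): the worst case is a vertex level with the middle of the
   geodesic. *)
have convex j : (k + j) * (k + j).+2 <= 2 * (k * k.+1 + j * j.+1).
  by have [+ _] := nat_Cauchy k j; rewrite -!mulnn; nia.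
by have := convex (D - k); rewrite subnKC.
Qed.

Lemma nb_closer_gt0 (x y : T) : e x y -> 0 < nb_closer e x y.
Proof.
by move=> exy; apply/card_gt0P; exists x; rewrite inE distxx dist_edge.
Qed.

(** The two consequences of the bound on m: the first settles exponents <= 0, the second feeds
    [power_sum_lt]. *)
Lemma card_edges_diameter_lt_wiener (R : realType) (a b : T) :
  (forall x, dist e a x <= dist e a b) -> 1 < #|T| ->
  (#|edges e|%:R <= 1 / 4 * (#|T|%:R `^ (4 / 3) - #|T|%:R `^ (1 / 3)) :> R)%R ->
  #|edges e| < #|vpairs T| /\ #|edges e| * dist e a b < \sum_(p in vpairs T) dist e p.1 p.2.
Proof.
move=> maxD n1; set c : R := (#|T|%:R `^ (1 / 3))%R; set D := dist e a b.
have D0 : 0 < D.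
  have /fintype.card_gt0P[x] : 0 < #|predC1 a| by rewrite cardC1; lia.
  rewrite inE => xa.
  by apply: leq_trans (maxD x); rewrite lt0n dist_eq0 eq_sym.
have nE : (#|T|%:R = c ^+ 3 :> R)%R.
  rewrite /c -powR_mulrn ?powR_ge0 // -powRrM.
  by rewrite (_ : 1 / 3 * 3%:R = 1)%R ?powRr1 //; field.
have c1 : (1 < c)%R.
  by rewrite -(@ltr_pXn2r _ 3) // ?nnegrE ?powR_ge0 // -nE expr1n ltr1n.
have -> : (#|T|%:R `^ (4 / 3) = c ^+ 4 :> R)%R.
  by rewrite /c -powR_mulrn ?powR_ge0 // -powRrM; congr (_ `^ _)%R; field.
set m := #|edges e| => le_m.
have cv := card_vpairs.
have cvR : (2 * #|vpairs T|%:R = c ^+ 3 * (c ^+ 3 - 1) :> R)%R.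
  have -> : (c ^+ 3 - 1 = #|T|.-1%:R :> R)%R by rewrite -nE -(ltn_predK n1) -natr1 addrK.
  by rewrite -nE -!natrM cv.
move: cvR le_m; rewrite (_ : c ^+ 4 - c = c * (c ^+ 3 - 1))%R; last by ring.
have c2 : (c ^+ 2 < c ^+ 3)%R by rewrite ltr_eXn2l.
have cc : (c < c ^+ 3)%R by rewrite -[X in (X < _)%R]expr1 ltr_eXn2l.
set q := (c ^+ 3)%R in nE c2 cc *; set V : R := (#|vpairs T|%:R)%R => cvR le_m.
have q1 : (0 < q - 1)%R by lra.
split.
  rewrite -(ltr_nat R) -/V.
  have : (c * (q - 1) < q * (q - 1))%R by rewrite ltr_pM2r.
  have : (0 < c * (q - 1))%R by apply: mulr_gt0 => //; lra.
  lra.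
(* If D <= 2c, counting each distance as at least 1 suffices; otherwise the geodesic bound is
   used. *)
have [leD|ltD] := lerP (D%:R : R)%R (2 * c)%R.
  apply: (@leq_trans #|vpairs T|).
    rewrite -(ltr_nat R) natrM -/V.
    have : (c ^+ 2 * (q - 1) < q * (q - 1))%R by rewrite ltr_pM2r.
    have := ler_pM (ler0n R m) (ler0n R D) le_m leD.
    lra.
  rewrite -sum1_card; apply: leq_sum => -[x y]; rewrite inE /= lt0n dist_eq0.
  by apply: contraTN => /eqP->; rewrite ltnn.
have := wiener_lower_bound maxD; rewrite -/D; set W := \sum_(_ in _) _.
rewrite -(ler_nat R) -(ltr_nat R) !natrM nE => leW.
have DR : (0 < D%:R :> R)%R by rewrite ltr0n.
have : (m%:R * D%:R <= 1 / 4 * (c * (q - 1)) * D%:R)%R by rewrite ler_pM2r.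
have : (0 < c * D%:R)%R by apply: mulr_gt0 => //; lra.
have : (q * (D%:R * (2 * c)) < q * (D%:R * D.+2%:R))%R.
  by rewrite !ltr_pM2l //; [rewrite -[D.+2]addn2 natrD; lra|lra].
lra.
Qed.
End Graph.

(** * Comparison of the two indices across exponents *)

Section Comparison.
Variables (R : realType) (T : finType) (e : rel T).
Hypotheses (e_simple : simple_graph e) (e_conn : connected_graph e).

Lemma dist_vpairs_gt0 : {in vpairs T, forall p, 0 < (dist e p.1 p.2)%:R :> R}.
Proof.
move=> -[x y]; rewrite inE /= ltr0n lt0n dist_eq0 //.
by apply: contraTN => /eqP->; rewrite ltnn.
Qed.

Lemma nb_closer_edges_gt0 :
  {in edges e, forall p, (0 < nb_closer e p.1 p.2 * nb_closer e p.2 p.1)%N}.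
Proof.
move=> -[x y]; rewrite inE /= => /andP[_ exy].
by rewrite muln_gt0 !nb_closer_gt0 // e_simple.1.
Qed.

(** An edge contributes 1 to the Wiener sum and at most 1 to the Szeged sum; a nonadjacent pair
    makes the inequality strict. *)
Lemma szeged_lt_wiener_nonpos (alpha : R) :
  (#|edges e| < #|vpairs T|)%N -> alpha <= 0 -> szeged e alpha < wiener e alpha.
Proof.
move=> lt_m alpha0.
have sEV : edges e \subset vpairs T by apply/fintype.subsetP => p; rewrite inE => /andP[].
have [q /setDP[qV qE]] : exists q, q \in vpairs T :\: edges e.
  apply/set0Pn; rewrite finset.setD_eq0; apply: contraTN lt_m => sVE.
  by rewrite -leqNgt subset_leq_card.
have le_Sz : szeged e alpha <= \sum_(p in edges e) (dist e p.1 p.2)%:R `^ alpha.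
  apply: ler_sum => p pE; have := pE; rewrite inE => /andP[_ /dist_edge ->] //.
  rewrite powR1 -[leRHS](powRr0 (nb_closer e p.1 p.2 * nb_closer e p.2 p.1)%:R).
  by apply: ler_powR => //; rewrite ler1n nb_closer_edges_gt0.
apply: (le_lt_trans le_Sz).
rewrite /wiener [ltRHS](big_setID (edges e)) /= (finset.setIidPr sEV) ltrDl.
rewrite (bigD1 q) /=; last by rewrite finset.in_setD qE qV.
apply: ltr_wpDr; first by apply: sumr_ge0 => p _; exact: powR_ge0.
by apply: powR_gt0; exact: dist_vpairs_gt0.
Qed.

Lemma continuous_szeged_sub_wiener : continuous (fun r : R => szeged e r - wiener e r).
Proof.
move=> r; apply: cvgB; apply: continuous_power_sum; last exact: dist_vpairs_gt0.
by move=> p pE; rewrite ltr0n nb_closer_edges_gt0.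
Qed.

End Comparison.

Theorem theorem13 (R : realType) (T : finType) (e : rel T) (n m : nat)
  (e_simple : simple_graph e) (e_conn : connected_graph e)
  (e_ncomplete : ~ complete_graph e)
  (card_T : #|T| = n) (card_E : #|edges e| = m)
  (le_m : m%:R <= 1 / 4 * (n%:R `^ (4 / 3) - n%:R `^ (1 / 3)) :> R) :
  exists alphaG : R, [/\ 0 < alphaG, alphaG <= 1 &
    forall alpha : R,
      [/\ alphaG < alpha -> wiener e alpha < szeged e alpha,
          alpha = alphaG -> szeged e alpha = wiener e alpha &
          alpha < alphaG -> szeged e alpha < wiener e alpha]].
Proof.
(* A graph on at most one vertex is vacuously complete. *)
have n1 : (1 < #|T|)%N.
  rewrite ltnNge; apply/negP => /fintype_le1P T1; apply: e_ncomplete => x y.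
  by rewrite (T1 x y) eqxx.
have [z0 _] := fintype.card_gt0P (ltnW n1).
pose ab := [arg max_(p > (z0, z0)) dist e p.1 p.2].
have maxD x y : (dist e x y <= dist e ab.1 ab.2)%N.
  by rewrite /ab; case: arg_maxnP => //= p _ /(_ (x, y) isT).
rewrite -card_T -card_E in le_m.
have [lt_m lt_mD] := card_edges_diameter_lt_wiener e_simple e_conn (maxD ab.1) n1 le_m.
have cross alpha beta : 0 < alpha <= 1 -> alpha < beta ->
    wiener e alpha <= szeged e alpha -> wiener e beta < szeged e beta :> R.
  apply: (@power_sum_lt _ _ _ _ _ _ _ (dist e ab.1 ab.2)%:R).
  - by move=> p pE; rewrite ltr0n nb_closer_edges_gt0.
  - by move=> p pV; rewrite dist_vpairs_gt0 // ler_nat maxD.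
  - rewrite ltr0n lt0n; apply: contraTN lt_mD => /eqP D0.
    rewrite -leqNgt big1 // => p _; apply/eqP.
    by have := maxD p.1 p.2; rewrite D0 leqn0.
  - by rewrite -natrM -natr_sum ltr_nat.
have neg alpha : alpha <= 0 -> szeged e alpha < wiener e alpha :> R.
  exact: szeged_lt_wiener_nonpos.
have pos1 : wiener e 1 <= szeged e 1 :> R.
  rewrite /wiener /szeged; under eq_bigr do rewrite powRr1 //.
  under [leRHS]eq_bigr do rewrite powRr1 //.
  by rewrite -!natr_sum ler_nat wiener_le_szeged.
have [|alphaG /itvP aG /eqP] := @IVT R (fun r => szeged e r - wiener e r) 0 1 0 ler01
    (continuous_subspaceT (continuous_szeged_sub_wiener e_simple e_conn)).
  apply/andP; split; first by rewrite ge_min subr_le0 ltW // neg.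
  by rewrite le_max !subr_ge0 pos1 orbT.
rewrite subr_eq0 => /eqP eqG.
(* The zero found in [0, 1] is not 0, where the difference is negative. *)
have aG0 : 0 < alphaG.
  by rewrite ltNge; apply/negP => /neg; rewrite eqG ltxx.
exists alphaG; split=> [||alpha]; rewrite ?aG //; split=> [lt_a|->|lt_a] //.
  by apply: cross lt_a _; rewrite ?aG0 ?aG ?eqG.
(* Between 0 and [alphaG], W <= Sz would propagate by [cross] to a strict inequality at [alphaG]. *)
have [|a0] := lerP alpha 0; first exact: neg.
rewrite ltNge; apply/negP => /(cross _ _ _ lt_a); rewrite eqG ltxx a0 /=.
by move/(_ (le_trans (ltW lt_a) _)); rewrite aG => /(_ isT).
Qed.
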